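(* Let $p,n$ be positive integers, let $K\subseteq\{0,1\}^n$ be a set of vectors each of Hamming weight exactly $p$, and let $C>2$ be a constant. Then there exists $K'\subseteq K$ such that ${\rm dr}(K')\le C$ and $|K'|\ge |K|^{\alpha}$, where $\alpha=1/\lceil \log(p/2)/\log(C/2)\rceil$.
   Context: The Hamming weight of $v\in\{0,1\}^n$ is the sum of its coordinates. The Hamming distance $\rho(u,v)$ between $u,v\in\{0,1\}^n$ is the number of coordinates where they differ. For a set $L\subseteq\{0,1\}^n$, the distance ratio is ${\rm dr}(L)=\max\{\rho(x,y): x,y\in L\}/\min\{\rho(x,y): x,y\in L,\ x\ne y\}$. The logarithms are to a common base (the ratio does not depend on the base).
   Formalization: When the ceiling is 0 (p = 2, or p = 1 and C > 4) the exponent α = 1/0 is undefined; there α is taken to be 1, and the claim is proved with that value. The distance ratio of a set with at most one element is taken to be 0. *)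

(* Defs.v *)
From mathcomp Require Import all_boot all_order all_algebra.
From mathcomp Require Import reals exp.

Set Implicit Arguments.
Unset Strict Implicit.
Unset Printing Implicit Defensive.

Import Order.TTheory GRing.Theory Num.Theory.
Local Open Scope ring_scope.

Definition cube (n : nat) : finType := {ffun 'I_n -> bool}.

Definition hweight (n : nat) (v : cube n) : nat := (\sum_(i < n) v i)%N.

Definition hdist (n : nat) (u v : cube n) : nat := #|[set i | u i != v i]|.

Definition max_hdist (n : nat) (L : {set cube n}) : nat :=
  (\max_(x in L) \max_(y in L) hdist x y)%N.

(* The default value n is neutral, since all distances are at most n. *)
Definition min_hdist (n : nat) (L : {set cube n}) : nat :=
  \big[minn/n]_(x in L) \big[minn/n]_(y in L | x != y) hdist x y.

(* If L has fewer than two elements, no pair contributes to the minimum, but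
   then the numerator is 0 and so is the ratio. *)
Definition dist_ratio (R : realType) (n : nat) (L : {set cube n}) : R :=
  (max_hdist L)%:R / (min_hdist L)%:R.

Definition log_ceil (R : realType) (p : nat) (C : R) : int :=
  Num.ceil (ln (p%:R / 2) / ln (C / 2)).

(* For C > 2 the denominator vanishes only if p = 2, or if p = 1 and C > 4.
   The exponent is then taken to be 1, as when the rounded-up value is 1.  The
   library's convention 1 / 0 = 0 would give the bound |K| ^ 0 = 1, which fails
   for the empty set. *)
Definition ratio_exponent (R : realType) (p : nat) (C : R) : R :=
  if log_ceil p C == 0 then 1 else 1 / (log_ceil p C)%:~R.

(* Main.v *)
Require Import Defs.
From mathcomp Require Import all_boot all_order all_algebra.
From mathcomp Require Import reals exp.
From mathcomp Require Import zify lra.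

Set Implicit Arguments.
Unset Strict Implicit.
Unset Printing Implicit Defensive.

Import Order.TTheory GRing.Theory Num.Theory.
Local Open Scope ring_scope.

(** Fix [m > 0] and suppose [m ^ t <= |K|].  Given a set of diameter at most [D],
    take a maximal subset whose points are pairwise at distance at least [D / C].
    Either it has [m] elements, and it is the set sought; or its fewer than [m]
    balls of radius [D / C] cover, so one of them keeps a fraction [1 / m] of the
    points, and the diameter has dropped by a factor [C / 2].  Distances between
    vectors of weight [p] lie between 2 and [2 p], so after [t - 1] such steps the
    diameter is at most [2 C] and all the remaining points can be taken. *)

Lemma hdist_sum n (u v : cube n) : hdist u v = (\sum_(i < n) (u i != v i))%N.
Proof.
rewrite /hdist -sum1_card big_mkcond; apply: eq_bigr => i _.
by rewrite inE; case: (_ != _).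
Qed.

Lemma hdistC n (u v : cube n) : hdist u v = hdist v u.
Proof. by rewrite !hdist_sum; apply: eq_bigr => i _; rewrite eq_sym. Qed.

Lemma hdist_triangle n (u v w : cube n) : (hdist u w <= hdist u v + hdist v w)%N.
Proof.
rewrite !hdist_sum -big_split /=; apply: leq_sum => i _.
by case: (u i); case: (v i); case: (w i).
Qed.

Lemma hdist_gt0 n (u v : cube n) : (0 < hdist u v)%N = (u != v).
Proof.
apply/idP/idP => [|uv].
  by apply: contraTneq => ->; rewrite hdist_sum big1 // => i _; rewrite eqxx.
apply/card_gt0P; apply/existsP; apply: contraNT uv => /existsPn h.
by apply/eqP/ffunP => i; apply/eqP; have:= h i; rewrite inE negbK.
Qed.

Lemma hdist_le n (u v : cube n) : (hdist u v <= n)%N.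
Proof. by rewrite -[leqRHS]card_ord max_card. Qed.

(** The two weights together count each differing coordinate once and each common one twice. Hence
    equal weights force an even distance, which is where the lower bound 2 comes from. *)
Lemma hdist_hweight n (u v : cube n) :
  (hdist u v + (\sum_(i < n) (u i && v i)).*2 = hweight u + hweight v)%N.
Proof.
rewrite hdist_sum -addnn -!big_split /=; apply: eq_bigr => i _.
by case: (u i); case: (v i).
Qed.

Lemma hdist_le_double n p (u v : cube n) :
  hweight u = p -> hweight v = p -> (hdist u v <= 2 * p)%N.
Proof. by move=> wu wv; have := hdist_hweight u v; rewrite wu wv; lia. Qed.

Lemma hdist_ge2 n (u v : cube n) :
  hweight u = hweight v -> u != v -> (2 <= hdist u v)%N.
Proof.
by move=> wuv; rewrite -hdist_gt0; have := hdist_hweight u v; rewrite wuv; lia.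
Qed.

Lemma dist_ratio_le (R : realType) n (L : {set cube n}) (C D : R) : 1 <= C ->
  {in L &, forall x y, (hdist x y)%:R <= C * D} ->
  {in L &, forall x y, x != y -> D <= (hdist x y)%:R} ->
  dist_ratio R L <= C.
Proof.
move=> C1 diam sep.
have C0 : 0 <= C by lra.
suff h : (max_hdist L)%:R <= C * (min_hdist L)%:R.
  rewrite /dist_ratio; case: (posnP (min_hdist L)) => [->|m0].
    by rewrite invr0 mulr0.
  by rewrite ler_pdivrMr ?ltr0n.
have max_n : (max_hdist L <= n)%N.
  by apply/bigmax_leqP => x _; apply/bigmax_leqP => y _; apply: hdist_le.
(* [P] passes through [minn], so it suffices to check it on each pair and on the default value [n],
   where it follows from [max_n] and [1 <= C]. *)
pose P d := (max_hdist L)%:R <= C * d%:R.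
have Pn : P n.
  rewrite /P (le_trans (_ : _ <= n%:R)) ?ler_nat //.
  by rewrite ler_peMl ?ler0n.
have Pmin a b : P a -> P b -> P (minn a b) by rewrite /minn; case: ifP.
apply: (big_ind P) => // u uL; apply: (big_ind P) => // v /andP[vL uv].
have D_uv : C * D <= C * (hdist u v)%:R by rewrite ler_wpM2l ?sep.
rewrite /P; pose Q d := d%:R <= C * (hdist u v)%:R.
have Q0 : Q 0%N by rewrite /Q mulr_ge0 ?ler0n.
have Qmax a b : Q a -> Q b -> Q (maxn a b) by rewrite /maxn; case: ifP.
apply: (big_ind Q) => // x xL; apply: (big_ind Q) => // y yL.
exact: le_trans (diam _ _ xL yL) D_uv.
Qed.

(** An inclusion-maximal [d]-separated subset covers: a point of [L] far from all of it could be
    added. *)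
Lemma exists_separated_net (R : realType) n (L : {set cube n}) (d : R) : 0 < d ->
  exists S : {set cube n}, [/\ S \subset L,
    {in S &, forall x y, x != y -> d <= (hdist x y)%:R} &
    forall y, y \in L -> exists2 x, x \in S & (hdist x y)%:R < d].
Proof.
move=> d0.
pose sep (S : {set cube n}) := (S \subset L) &&
  [forall x in S, forall y in S, (x != y) ==> (d <= (hdist x y)%:R)].
have sep0 : sep set0.
  by rewrite /sep sub0set; apply/forall_inP => x; rewrite inE.
have [S /maxsetP[/andP[SL /forall_inP sepS] maxS] _] := maxset_exists sep0.
have {}sepS : {in S &, forall x y, x != y -> d <= (hdist x y)%:R}.
  by move=> x y xS yS; move/forall_inP: (sepS x xS) => /(_ y yS) /implyP.
exists S; split=> // y yL.
have [/exists_inP[x xS xy]|/exists_inPn far] :=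
  boolP [exists x in S, (hdist x y)%:R < d]; first by exists x.
have {}far x : x \in S -> d <= (hdist x y)%:R by move/far; rewrite -leNgt.
have yS : y \in S.
  rewrite -(maxS (y |: S)) ?setU11 ?subsetUr // /sep subUset sub1set yL SL /=.
  apply/forall_inP => u uS; apply/forall_inP => v vS; apply/implyP.
  case/setU1P: uS => [->|uS]; case/setU1P: vS => [->|vS]; rewrite ?eqxx // => uv.
  - by rewrite hdistC far.
  - exact: far.
  - exact: sepS.
exists y => //; suff -> : hdist y y = 0%N by [].
by apply/eqP; rewrite -leqn0 leqNgt hdist_gt0 eqxx.
Qed.

(** Pigeonhole: if every fibre had fewer than [M] points, their union [L] would have fewer than
    [m * M]. *)
Lemma exists_large_fibre (R : realType) (T : finType) (L S : {set T})
    (r : T -> T -> bool) (m M : R) :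
  0 < m -> 0 < M -> #|S|%:R <= m -> m * M <= #|L|%:R ->
  (forall y, y \in L -> exists2 x, x \in S & r x y) ->
  exists2 x, x \in S & M <= #|[set y in L | r x y]|%:R.
Proof.
move=> m0 M0 Sm mL cov.
pose B x := [set y in L | r x y].
have [/exists_inP[x xS MB]|/exists_inPn small] :=
  boolP [exists x in S, M <= #|B x|%:R :> R]; first by exists x.
(* One actual centre makes the inequality between the sums strict. *)
have [z zS] : exists z, z \in S.
  have [z zL] : exists z, z \in L.
    by apply/card_gt0P; rewrite -(ltr_nat R) (lt_le_trans _ mL) ?mulr_gt0.
  by have [x xS _] := cov z zL; exists x.
have LB : (#|L| <= \sum_(x in S) #|B x|)%N.
  have /subset_leq_card/leq_trans : L \subset \bigcup_(x in S) B x.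
    apply/subsetP => y yL; have [x xS xy] := cov y yL.
    by apply/bigcupP; exists x => //; rewrite inE yL.
  apply; elim/big_rec2: _ => [|x k A _ Ak]; first by rewrite cards0.
  by rewrite (leq_trans (leq_card_setU _ _)) ?leq_add2l.
suff : \sum_(x in S) #|B x|%:R < \sum_(x in S) M.
  rewrite sumr_const -natr_sum -[M *+ _]mulr_natl ltNge => /negP[].
  apply: (le_trans (ler_wpM2r (ltW M0) Sm)); apply: (le_trans mL).
  by rewrite ler_nat.
rewrite (bigD1 z) //= [ltRHS](bigD1 z) //= ltr_leD //.
  by rewrite ltNge small.
by apply: ler_sum => x /andP[xS _]; rewrite ltW // ltNge small.
Qed.

Lemma exists_dist_ratio_le (R : realType) n s (C m : R) (L : {set cube n}) :
  2 < C -> 0 < m -> m ^+ s.+1 <= #|L|%:R ->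
  {in L &, forall x y, x != y -> (2 <= hdist x y)%N} ->
  {in L &, forall x y, (hdist x y)%:R <= 4 * (C / 2) ^+ s.+1} ->
  exists K' : {set cube n},
    [/\ K' \subset L, dist_ratio R K' <= C & m <= #|K'|%:R].
Proof.
move=> C2 m0; have C1 : 1 <= C by lra.
elim: s L => [|s IH] L mL sep diam.
  exists L; split; [exact: subxx | | by rewrite -[m]expr1].
  apply: (@dist_ratio_le _ _ _ C 2) => // [x y xL yL|x y xL yL xy].
    by apply: (le_trans (diam x y xL yL)); lra.
  by rewrite ler_nat sep.
(* This is the current diameter bound divided by [C]. A ball of radius [d] has diameter at most
   [2 * d], which is the bound for the next step. *)
pose d : R := 2 * (C / 2) ^+ s.+1.
have d0 : 0 < d by rewrite mulr_gt0 // exprn_gt0 //; lra.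
have [S [SL sepS cov]] := exists_separated_net L d0.
have [mS|Sm] := leP m #|S|%:R.
  exists S; split=> //; apply: dist_ratio_le C1 _ sepS => x y xS yS.
  rewrite (le_trans (diam x y _ _)) ?(subsetP SL) // exprS /d.
  by lra.
have [|x xS] := exists_large_fibre m0 (exprn_gt0 s.+1 m0) (ltW Sm) _ cov.
  by rewrite -exprS.
set B := [set _ in _ | _] => mB.
have BL : B \subset L by apply/subsetP => y; rewrite inE => /andP[].
have [||K' [K'B dr mK']] := IH B mB.
- by move=> y z yB zB; apply: sep; apply: (subsetP BL).
- move=> y z; rewrite !inE => /andP[_ xy] /andP[_ xz].
  have : (hdist y z)%:R <= (hdist x y)%:R + (hdist x z)%:R :> R.
    by rewrite -natrD ler_nat (hdistC x y) hdist_triangle.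
  by move: xy xz; rewrite /d; lra.
by exists K'; split=> //; apply: subset_trans BL.
Qed.

Theorem theorem2 (R : realType) (p n : nat) (hp : (0 < p)%N) (hn : (0 < n)%N)
    (K : {set cube n}) (hK : forall v, v \in K -> hweight v = p)
    (C : R) (hC : 2 < C) :
  exists K' : {set cube n},
    [/\ K' \subset K,
        dist_ratio R K' <= C
      & #|K|%:R `^ ratio_exponent p C <= #|K'|%:R :> R].
Proof.
have sep : {in K &, forall x y, x != y -> (2 <= hdist x y)%N}.
  by move=> x y xK yK; apply: hdist_ge2; rewrite !hK.
have C2_gt1 : 1 < C / 2 by lra.
have lnC_gt0 : 0 < ln (C / 2) by rewrite ln_gt0.
(* Taking logarithms, the hypothesis says [p / 2 <= (C / 2) ^+ s], that is,
   [2 * p <= 4 * (C / 2) ^+ s]. *)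
have diam s : log_ceil p C <= s%:Z ->
    {in K &, forall x y, (hdist x y)%:R <= 4 * (C / 2) ^+ s}.
  move=> ks x y xK yK.
  have p0 : 0 < p%:R / 2 :> R by rewrite divr_gt0 ?ltr0n.
  have Cs0 : 0 < (C / 2) ^+ s by rewrite exprn_gt0 //; lra.
  have : p%:R / 2 <= (C / 2) ^+ s.
    rewrite -ler_ln ?posrE // lnXn ?(lt_trans ltr01) // -[leRHS]mulr_natl.
    by move: ks; rewrite /log_ceil ceil_le_int ler_pdivrMr.
  have : (hdist x y)%:R <= 2 * p%:R :> R.
    by rewrite -natrM ler_nat hdist_le_double ?hK.
  by lra.
(* For empty [K] the power must be 0, whereas a zero exponent would make it 1. *)
have k_exp : ratio_exponent p C != 0.
  rewrite /ratio_exponent; case: ifPn => [_|k0]; first exact: oner_neq0.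
  by rewrite div1r invr_eq0 intr_eq0.
have [K0|Kn0] := posnP #|K|.
  exists K; split; rewrite ?subxx ?K0 ?powR0 //.
  move/eqP: K0; rewrite cards_eq0 => /eqP->.
  by rewrite /dist_ratio /max_hdist big_set0 mul0r; lra.
have K1 : 1 <= #|K|%:R :> R by rewrite ler1n.
have m0 : 0 < #|K|%:R `^ ratio_exponent p C.
  by rewrite powR_gt0 // (lt_le_trans ltr01).
(* A positive [log_ceil p C] is itself [s.+1]. Otherwise [s = 0] works: the exponent is at most 1
   and [1 <= #|K|]. *)
have [s []] : exists s, log_ceil p C <= s.+1%:Z /\
    (#|K|%:R `^ ratio_exponent p C) ^+ s.+1 <= #|K|%:R.
  rewrite /ratio_exponent; case: (log_ceil p C) => [[|s]|s].
  - by exists 0%N; rewrite eqxx powRr1 ?expr1.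
  - exists s; split=> //=; rewrite -powR_mulrn ?powR_ge0 // -powRrM.
    by rewrite mulfVK ?powRr1 // pnatr_eq0.
  - exists 0%N; split=> //=; rewrite expr1 -[leRHS]powRr1 ?ler_powR //.
    rewrite NegzE mulrNz div1r invrN (@le_trans _ _ 0) ?ler01 // oppr_le0 invr_ge0.
    exact: ler0n.
move=> /diam diamK mK.
exact: exists_dist_ratio_le hC m0 mK sep diamK.
Qed.
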